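(* Let $C_{3}$ be the simplicial complex obtained from $3$ disjoint copies of $Q^*$ by identifying them along the subcomplex $A^*$. Then $C_3$ is balanced, Cohen-Macaulay (over any field), and not partitionable. (Its $f$-vector is $(1,22,101,140,60)$.)
   Context: $Q^*$ is the $3$-dimensional simplicial complex on vertex set $\{0,1,\dots,13\}$ whose faces are all subsets of the following $20$ facets: $\{2,5,6,12\}$, $\{1,5,8,11\}$, $\{0,1,2,5\}$, $\{1,4,8,9\}$, $\{1,2,3,10\}$, $\{4,5,8,13\}$, $\{0,1,2,3\}$, $\{1,4,9,10\}$, $\{1,2,9,10\}$, $\{1,2,5,6\}$, $\{0,2,5,12\}$, $\{4,5,7,13\}$, $\{1,4,5,8\}$, $\{1,2,6,9\}$, $\{1,3,4,7\}$, $\{1,3,4,10\}$, $\{1,5,6,11\}$, $\{1,4,5,7\}$, $\{1,6,9,11\}$, $\{1,8,9,11\}$. $A^*$ is the induced subcomplex of $Q^*$ on vertex set $\{0,2,3,4,6,7,8,10,12,13\}$; its facets are $\{0,2,3\}$, $\{4,7,13\}$, $\{3,4,10\}$, $\{0,2,12\}$, $\{3,4,7\}$, $\{2,3,10\}$, $\{2,6,12\}$, $\{4,8,13\}$. Identifying $N$ copies of $Q^*$ along $A^*$ means taking copies $Q^*_1,\dots,Q^*_N$ with pairwise disjoint vertex sets except that the vertices of $A^*$ are shared (the same in all copies). A $(d-1)$-dimensional complex is balanced if its graph is properly $d$-colorable. A pure simplicial complex with facets $F_1,\dots,F_n$ is partitionable if its faces are the disjoint union of Boolean intervals $[R_i,F_i]=\{G: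 R_i\subseteq G\subseteq F_i\}$. A $(d-1)$-dimensional complex $\Delta$ is Cohen-Macaulay over a field $\mathbb{F}$ if for every face $F$ (including $\emptyset$), $\widetilde{H}_i(\mathrm{lk}_\Delta(F);\mathbb{F})=0$ for all $i\neq d-1-\#F$, where $\mathrm{lk}_\Delta(F)=\{G\in\Delta: G\cap F=\emptyset, G\cup F\in\Delta\}$. The $f$-vector lists the numbers of faces of dimensions $-1,0,1,2,3$. *)

(* Defs.v *)
From HB Require Import structures.
From mathcomp Require Import all_boot all_order all_algebra.
Set Implicit Arguments. Unset Strict Implicit. Unset Printing Implicit Defensive.
Import Order.TTheory GRing.Theory Num.Theory.

Section Complexes.
Variable V : finType.
Implicit Types (D : {set {set V}}) (F G H : {set V}).

Definition faces_card D (k : nat) : {set {set V}} := [set G in D | #|G| == k].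

Definition facets D : {set {set V}} :=
  [set F in D | [forall G in D, (F \subset G) ==> (G == F)]].

Definition link D F : {set {set V}} :=
  [set G in D | [disjoint G & F] && (G :|: F \in D)].

Definition balanced D (d : nat) : Prop :=
  exists kappa : V -> 'I_d,
    forall G, G \in D -> #|G| = 2 ->
      forall x y, x \in G -> y \in G -> x != y -> kappa x != kappa y.

Definition partitionable D : Prop :=
  exists R : {set V} -> {set V},
    [/\ (forall F, F \in facets D -> R F \subset F),
        (forall G, G \in D <->
           exists F, [/\ F \in facets D, R F \subset G & G \subset F]) &
        (forall G F1 F2, F1 \in facets D -> F2 \in facets D ->
           R F1 \subset G -> G \subset F1 ->
           R F2 \subset G -> G \subset F2 -> F1 = F2)].

Local Open Scope ring_scope.

(* Simplicial boundary map from the chains on faces of cardinality k to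
   chains on faces of cardinality k-1 (row-vector convention), over a
   field K.  Vertices are ordered by enum_rank; the sign of the face
   G \ {v} in the boundary of G is (-1)^(number of vertices of G below v). *)
Definition bdmx (K : fieldType) D (k : nat) :
    'M[K]_(#|faces_card D k|, #|faces_card D k.-1|) :=
  \matrix_(i, j)
    let G : {set V} := enum_val i in let H : {set V} := enum_val j in
    if (H \subset G) && (#|G :\: H| == 1%N) then
      (-1) ^+ #|[set p in setX H (G :\: H) | (enum_rank p.1 < enum_rank p.2)%N]|
    else 0.

(* reduced homology in degree i vanishes:  ker d_{i} <= im d_{i+1},
   where chains of degree i are those on faces of cardinality i+1
   (degrees i < -1 have zero chain groups). *)
Definition rhom_vanishes (K : fieldType) D (i : int) : Prop :=
  forall k : nat, (k%:Z = i + 1)%R ->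
    (kermx (bdmx K D k) <= bdmx K D k.+1)%MS.

(* Cohen-Macaulay over K, for a (d-1)-dimensional complex *)
Definition cohen_macaulay (K : fieldType) D (d : nat) : Prop :=
  forall F, F \in D -> forall i : int,
    i != (d%:Z - 1 - #|F|%:Z)%R -> rhom_vanishes K (link D F) i.

End Complexes.

Definition Qfacets : seq (seq nat) :=
  [:: [:: 2;5;6;12]; [:: 1;5;8;11]; [:: 0;1;2;5]; [:: 1;4;8;9];
      [:: 1;2;3;10]; [:: 4;5;8;13]; [:: 0;1;2;3]; [:: 1;4;9;10];
      [:: 1;2;9;10]; [:: 1;2;5;6]; [:: 0;2;5;12]; [:: 4;5;7;13];
      [:: 1;4;5;8]; [:: 1;2;6;9]; [:: 1;3;4;7]; [:: 1;3;4;10];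
      [:: 1;5;6;11]; [:: 1;4;5;7]; [:: 1;6;9;11]; [:: 1;8;9;11]].

Definition Avert : seq nat := [:: 0;2;3;4;6;7;8;10;12;13].

Definition qface (s : seq nat) : {set 'I_14} := [set x : 'I_14 | val x \in s].

Definition Qstar : {set {set 'I_14}} :=
  [set G : {set 'I_14} | has (fun s => G \subset qface s) Qfacets].

Definition Astar : {set {set 'I_14}} :=
  [set G in Qstar | G \subset qface Avert].

(* Vertices of the glued complex: pairs (v, j) = vertex v of copy j;
   vertices of A^* are shared, represented by copy 0. *)
Definition Vtx := ('I_14 * 'I_3)%type.

Definition emb (j : 'I_3) (v : 'I_14) : Vtx :=
  if v \in qface Avert then (v, ord0) else (v, j).

Definition C3 : {set {set Vtx}} :=
  [set G : {set Vtx} | [exists j : 'I_3, [exists F in Qstar, G == emb j @: F]]].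

(* Main.v *)
Require Import Defs.
From HB Require Import structures.
From mathcomp Require Import all_boot all_order all_algebra.
Set Implicit Arguments. Unset Strict Implicit. Unset Printing Implicit Defensive.
Import Order.TTheory GRing.Theory Num.Theory.

(* Cohen-Macaulayness: suppose the (k+1)-element faces of a complex contain a
   list H_1, ..., H_n such that each H_i has a k-element face lying in no H_j
   with j > i.  Then the boundaries of the H_i are triangular with entries 1 and
   -1 on the diagonal, so the boundary map has rank at least n over every field.
   In every link of C_3 such lists are long enough, in all degrees below the top
   one, for the ranks of two consecutive boundary maps to add up to the number of
   faces between them; together with "boundary of boundary is zero" this forces
   exactness.

   Non-partitionability: by a Farkas certificate, if the intervals of a
   partitioning that belong to one copy of Q^* contained neither of the edges
   {2, 6} and {4, 8} of A^*, then each of them would have nonpositive weight for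
   a certain weight on the faces of that copy outside A^*, whose total weight is
   nevertheless 1.  So each of the three copies owns an interval containing one of
   these two edges, and two copies must own the same one. *)

(** * Ranks of simplicial boundary maps *)

(** An entry of [bdmx], read on sets instead of enumeration indices, so that sums over faces can be
    split term by term. *)
Definition incidence (K : fieldType) (V : finType) (G H : {set V}) : K :=
  if (H \subset G) && (#|G :\: H| == 1%N) then
    ((-1) ^+ #|[set p in setX H (G :\: H) | (enum_rank p.1 < enum_rank p.2)%N]|)%R
  else 0%R.

Definition rank_below (V : finType) (H : {set V}) (v : V) : nat :=
  #|[set h in H | enum_rank h < enum_rank v]|.

Lemma incidence_setU1 (K : fieldType) (V : finType) (H : {set V}) (v : V) :
  v \notin H -> incidence K (v |: H) H = ((-1) ^+ rank_below H v)%R.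
Proof.
move=> vH; rewrite /incidence subsetUr.
have -> : (v |: H) :\: H = [set v].
  by apply/setP=> x; rewrite !inE; case: (x =P v) => [->|_] /=;
    rewrite ?vH ?andbT ?andNb.
rewrite cards1 eqxx /=; congr (_ ^+ _)%R.
have inj : injective (fun h : V => (h, v)) by move=> x y [].
apply: etrans (card_imset _ inj); apply: eq_card => -[x y].
rewrite !inE /=; apply/andP/imsetP => [[/andP[xH /eqP->] lt_xv]|[z]].
  by exists x => //; rewrite inE xH.
by rewrite inE => /andP[zH lt_zv] [-> ->]; rewrite zH eqxx.
Qed.

Lemma incidence_neq0 (K : fieldType) (V : finType) (G H : {set V}) :
  (incidence K G H != 0)%R = (H \subset G) && (#|G :\: H| == 1).
Proof.
rewrite /incidence; case: ifP => _; last by rewrite eqxx.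
by rewrite expf_eq0 oppr_eq0 oner_eq0 andbF.
Qed.

Lemma rank_below_setU1 (V : finType) (H : {set V}) (u v : V) :
  u \notin H ->
  rank_below (u |: H) v = (enum_rank u < enum_rank v) + rank_below H v.
Proof.
move=> uH; rewrite /rank_below.
have [lt_uv|ge_uv] := boolP (enum_rank u < enum_rank v).
  have := cardsU1 u [set h in H | enum_rank h < enum_rank v].
  rewrite inE (negPf uH) /= => <-; apply: eq_card => x.
  by rewrite !inE; case: eqP => // ->; rewrite lt_uv.
apply: eq_card => x; rewrite !inE; case: eqP => //= ->.
by rewrite (negPf ge_uv) (negPf uH).
Qed.

(** If [u] precedes [v], adding [u] to [E] flips the sign of [v], while adding [v] leaves that of
    [u] unchanged; so the two ways down to [E] have opposite signs. *)
Lemma incidence_cancel (K : fieldType) (V : finType) (E : {set V}) (u v : V) :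
  u != v -> u \notin E -> v \notin E ->
  (incidence K (u |: (v |: E)) (v |: E) * incidence K (v |: E) E +
   incidence K (u |: (v |: E)) (u |: E) * incidence K (u |: E) E = 0)%R.
Proof.
wlog lt_uv : u v / enum_rank u < enum_rank v => [IH uv uE vE|].
  have : enum_rank u != enum_rank v by rewrite (inj_eq enum_rank_inj).
  rewrite neq_ltn => /orP[lt_uv|lt_vu]; first exact: IH.
  by rewrite addrC setUCA; apply: IH; rewrite // eq_sym.
move=> uv uE vE.
have uvE : u \notin v |: E by rewrite !inE negb_or uv.
have vuE : v \notin u |: E by rewrite !inE negb_or eq_sym uv.
rewrite {2}setUCA !incidence_setU1 // !rank_below_setU1 //.
rewrite lt_uv ltnNge (ltnW lt_uv) /= add0n exprS.
by rewrite mulN1r mulNr mulrC subrr.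
Qed.

Lemma bdmx_mul0 (K : fieldType) (V : finType) (D : {set {set V}}) (k : nat) :
  (forall G H : {set V}, G \in D -> H \subset G -> H \in D) ->
  (bdmx K D k.+1 *m bdmx K D k = 0)%R.
Proof.
move=> closedD; apply/matrixP=> i j; rewrite !mxE.
have /setIdP[GD /eqP cG] := enum_valP i; have /setIdP[ED /eqP cE] := enum_valP j.
set G := enum_val i in GD cG *; set E := enum_val j in ED cE *.
under eq_bigr do rewrite !mxE -!/(incidence _ _ _) -/G -/E.
rewrite -(big_enum_val (fun H => incidence K G H * incidence K H E)%R) /=.
case: k j @E ED cE i @G GD cG => [|k] j E ED cE i G GD cG.
  (* For [k = 0] the predecessor [k.-1] is again 0: both [H] and [E] are empty, so the second factor
     vanishes. *)
  rewrite big1 // => H /setIdP[_ /eqP cH].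
  have -> : (incidence K H E = 0)%R; last by rewrite mulr0.
  apply/eqP/negPn; rewrite incidence_neq0 negb_and; apply/orP; right.
  by rewrite (cards0_eq cH) set0D cards0.
have [sEG|nsEG] := boolP (E \subset G); last first.
  rewrite big1 // => H _; apply/eqP; rewrite mulf_eq0.
  apply: contraNT nsEG; rewrite negb_or !incidence_neq0.
  by case/andP=> /andP[sHG _] /andP[sEH _]; apply: subset_trans sHG.
(* Only [u |: E] and [v |: E] lie strictly between [E] and [G], and their two terms cancel. *)
have : #|G :\: E| == 2 by rewrite cardsDS // cG cE /= subSn // subSnn.
case/cards2P=> u [v [uv dGE]].
have /andP[uE uG] : (u \notin E) && (u \in G) by rewrite -in_setD dGE !inE eqxx.
have /andP[vE vG] : (v \notin E) && (v \in G) by rewrite -in_setD dGE !inE eqxx orbT.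
have defG : G = u |: (v |: E).
  by rewrite setUA -dGE -{1}(setID G E) (setIidPr sEG) setUC.
have uvE : u \notin v |: E by rewrite !inE negb_or uv.
have vuE : v \notin u |: E by rewrite !inE negb_or eq_sym uv.
have DvE : v |: E \in faces_card D k.+1.
  rewrite inE cardsU1 vE cE eqxx andbT; apply: closedD GD _.
  by rewrite defG subsetUr.
have DuE : u |: E \in faces_card D k.+1.
  rewrite inE cardsU1 uE cE eqxx andbT; apply: closedD GD _.
  by rewrite defG setUCA subsetUr.
rewrite (bigD1 _ DvE) (bigD1 (u |: E)) /=; last first.
  apply/andP; split; first exact: DuE.
  by apply: contraNneq uvE => <-; rewrite !inE eqxx.
rewrite addrA defG incidence_cancel // add0r big1 // => H.
case/andP=> /andP[/setIdP[_ /eqP cH] nHv] nHu.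
apply/eqP; rewrite mulf_eq0 -[_ || _]negbK negb_or !incidence_neq0.
apply/negP=> /andP[/andP[sHG _] /andP[sEH /cards1P[w dHE]]].
have defH : H = w |: E by rewrite -dHE -{1}(setID H E) (setIidPr sEH) setUC.
have /setDP[wH wE] : w \in H :\: E by rewrite dHE inE.
have := subsetP sHG _ wH; rewrite !inE (negPf wE) orbF => /orP[] /eqP ew.
  by rewrite defH ew eqxx in nHu.
by rewrite defH ew eqxx in nHv.
Qed.

(* Listed from its end, the sequence is such that every set brings a new face
   of codimension one; the boundaries of its members are then independent. *)
Fixpoint peelable (V : finType) (Hs : seq {set V}) : bool :=
  if Hs is H :: Hs' then
    [exists v in H, ~~ has (fun H' : {set V} => H :\ v \subset H') Hs']
    && peelable Hs'
  else true.

(** Each head [H] enlarges the span [S] of the boundaries of its tail: its boundary has a nonzero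
    coordinate at [H :\ v], where all those of the tail vanish. *)
Lemma peelable_rank (K : fieldType) (V : finType) (D : {set {set V}})
    (k : nat) (Hs : seq {set V}) :
  (forall G H : {set V}, G \in D -> H \subset G -> H \in D) ->
  {subset Hs <= faces_card D k.+1} -> peelable Hs ->
  size Hs <= \rank (bdmx K D k.+1).
Proof.
move=> closedD sHs peelHs.
pose r (H : {set V}) := (\row_(j < #|faces_card D k|) incidence K H (enum_val j))%R.
pose S (T : seq {set V}) : 'M[K]_#|faces_card D k| :=
  (\sum_(H <- T) <<r H>>)%MS.
have: (S Hs <= bdmx K D k.+1)%MS.
  rewrite /S big_seq; elim/big_ind: _ => [|A B sA sB|H /sHs HD].
  - exact: sub0mx.
  - by rewrite addsmx_sub sA sB.
  rewrite genmxE; set i := enum_rank_in HD H.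
  have -> : r H = row i (bdmx K D k.+1); last exact: row_sub.
  by apply/rowP=> j; rewrite !mxE /i enum_rankK_in.
move/mxrankS; apply: leq_trans.
elim: Hs sHs peelHs => //= H Hs IH sHs /andP[/exists_inP[v vH nHv] peelHs].
have{}IH : size Hs <= \rank (S Hs).
  by apply: IH => // x xHs; apply: sHs; rewrite inE xHs orbT.
rewrite /S big_cons -/(S Hs); apply: leq_ltn_trans IH _.
rewrite ltnNge; apply: contra nHv => le_rank.
have /setIdP[HD /eqP cH] := sHs H (mem_head _ _).
have HvD : H :\ v \in faces_card D k.
  rewrite inE (closedD _ _ HD) ?subsetDl //=.
  by move: cH; rewrite (cardsD1 v) vH add1n => -[->].
set j := enum_rank_in HvD (H :\ v).
have jE : enum_val j = H :\ v by rewrite /j enum_rankK_in.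
apply: contraLR le_rank => nHs; rewrite -ltnNge.
have SrH : (S Hs < <<r H>> + S Hs)%MS.
  2: by rewrite ltmxErank in SrH; case/andP: SrH.
rewrite /ltmx addsmxSr addsmx_sub negb_and genmxE; apply/orP; left.
apply/negP=> sr.
(* The kernel of this column is the hyperplane of chains with coordinate zero at [H :\ v]. *)
have SK : (S Hs <= kermx (delta_mx j ord0 : 'cV_#|faces_card D k|))%MS.
  rewrite /S big_seq; elim/big_ind: _ => [|A B sA sB|H' H'Hs].
  - exact: sub0mx.
  - by rewrite addsmx_sub sA sB.
  rewrite genmxE; apply/sub_kermxP/rowP=> i; rewrite -colE !mxE jE.
  apply/eqP; rewrite -[_ == _]negbK incidence_neq0; apply/negP=> /andP[sub _].
  by case/hasP: nHs; exists H'.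
have /sub_kermxP/rowP/(_ ord0)/eqP := submx_trans sr SK.
rewrite -colE !mxE jE; apply/negP.
rewrite incidence_neq0 subsetDl /=.
by rewrite setDDr setDv set0U (setIidPr _) ?cards1 // sub1set.
Qed.

(** The image lies in the kernel, whose dimension is at most (a + b) - a = b, hence at most the rank
    of the image; so the two coincide. *)
Lemma rhom_vanishes_rank (K : fieldType) (V : finType) (D : {set {set V}})
    (k a b : nat) :
  (forall G H : {set V}, G \in D -> H \subset G -> H \in D) ->
  #|faces_card D k| <= a + b ->
  a <= \rank (bdmx K D k) -> b <= \rank (bdmx K D k.+1) ->
  (kermx (bdmx K D k) <= bdmx K D k.+1)%MS.
Proof.
move=> closedD le_f le_a le_b.
have sub : (bdmx K D k.+1 <= kermx (bdmx K D k))%MS.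
  by apply/sub_kermxP; apply: bdmx_mul0.
rewrite -(geq_leqif (mxrank_leqif_sup sub)) mxrank_ker leq_subLR.
by apply: leq_trans le_f (leq_add _ _).
Qed.

(** * Faces as lists of natural numbers *)

Fixpoint subseqs (T : Type) (s : seq T) : seq (seq T) :=
  if s is x :: s' then map (cons x) (subseqs s') ++ subseqs s' else [:: [::]].

Lemma mem_subseqs (T : eqType) (s t : seq T) : (t \in subseqs s) = subseq t s.
Proof.
elim: s t => [|x s IH] [|y t] //=; rewrite mem_cat ?IH ?sub0seq ?orbT //.
case: eqP => [->|ne_yx].
  have cons_inj : injective (cons x) by move=> u v [].
  rewrite (mem_map cons_inj) IH.
  apply/orP/idP => [[//|]|]; last by left.
  exact: subseq_trans (subseq_cons _ _).
by rewrite orb_idl // => /mapP[u _ [/ne_yx]].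
Qed.

(* With this numbering every copy of a strictly increasing list of vertices of
   Q^* is again strictly increasing. *)
Definition code (x : Vtx) : nat := 3 * x.1 + x.2.

Definition cset (s : seq nat) : {set Vtx} := [set x | code x \in s].

(** Here 42 = 3 * 14 is the number of codes. Each set of vertices has exactly one such list, so
    inclusion of faces becomes the computable [subseq]. *)
Definition coded (s : seq nat) : bool := sorted ltn s && all (gtn 42) s.

Lemma code_inj : injective code.
Proof.
move=> [[u hu] [i hi]] [[v hv] [j hj]]; rewrite /code /= => e.
have ei : i = j.
  by have := congr1 (modn^~ 3) e; rewrite !(mulnC 3) !modnMDl !modn_small.
have eu : u = v by move/eqP: e; rewrite ei eqn_add2r eqn_pmul2l // => /eqP.
by congr (_, _); apply: val_inj.
Qed.

Lemma code_onto n : n < 42 -> exists x, code x = n.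
Proof.
move=> lt_n.
have lt1 : n %/ 3 < 14 by rewrite ltn_divLR.
have lt2 : n %% 3 < 3 by rewrite ltn_mod.
by exists (Ordinal lt1, Ordinal lt2); rewrite /code /= mulnC -divn_eq.
Qed.

Lemma cset_subset s t : coded s -> (cset s \subset cset t) = all (mem t) s.
Proof.
case/andP=> _ /allP lt_s; apply/subsetP/allP => [sub n ns|sub x]; last first.
  by rewrite !inE => /sub.
by have [x ex] := code_onto (lt_s n ns); have := sub x; rewrite !inE ex => ->.
Qed.

Lemma cset_subseq s t : coded s -> coded t -> (cset s \subset cset t) = subseq s t.
Proof.
move=> cs ct; rewrite cset_subset //; apply/allP/idP => [sub|/mem_subseq//].
have [ss /andP[st _]] : sorted ltn s /\ coded t by case/andP: cs.
suff -> : s = [seq x <- t | x \in s] by exact: filter_subseq.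
apply: (irr_sorted_eq ltn_trans ltnn) => //.
  exact: sorted_filter ltn_trans _ _ st.
by move=> x; rewrite mem_filter; case xs: (x \in s) => //=; rewrite -(sub x xs).
Qed.

Lemma cset_inj s t : coded s -> coded t -> cset s = cset t -> s = t.
Proof.
move=> cs ct e; apply/eqP.
have sub1 : subseq s t by rewrite -cset_subseq // e.
have sub2 : subseq t s by rewrite -cset_subseq // e.
by rewrite -(size_subseq_leqif sub1).2 eqn_leq !size_subseq.
Qed.

Lemma card_cset s : coded s -> #|cset s| = size s.
Proof.
case/andP=> ss /allP lt_s; rewrite cardE -(size_map code).
apply/perm_size/uniq_perm; rewrite ?(map_inj_uniq code_inj) ?enum_uniq //.
  exact: sorted_uniq ltn_trans ltnn _ ss.
move=> n; apply/mapP/idP => [[x]|ns]; first by rewrite mem_enum inE => xs ->.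
by have [x ex] := code_onto (lt_s n ns); exists x; rewrite ?mem_enum ?inE ex.
Qed.

Lemma subseq_coded s t : subseq s t -> coded t -> coded s.
Proof.
move=> sub /andP[st lt_t]; apply/andP; split.
  exact: subseq_sorted ltn_trans _ _ sub st.
by apply/allP=> x /(mem_subseq sub); apply: (allP lt_t).
Qed.

Lemma sub_cset (G : {set Vtx}) t :
  coded t -> G \subset cset t -> exists2 s, subseq s t & G = cset s.
Proof.
move=> ct sub; exists [seq n <- t | n \in [seq code x | x in G]].
  exact: filter_subseq.
apply/setP=> x; rewrite !inE mem_filter mem_map; last exact: code_inj.
rewrite mem_enum; case xG: (x \in G) => //=.
by have := subsetP sub x xG; rewrite inE => ->.
Qed.

(** * Complexes generated by lists, their faces and links *)

Definition generated (Fs : seq (seq nat)) : {set {set Vtx}} :=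
  [set G : {set Vtx} | has (fun f => G \subset cset f) Fs].

Definition faces_of (Fs : seq (seq nat)) (k : nat) : seq (seq nat) :=
  undup (flatten [seq [seq s <- subseqs f | size s == k] | f <- Fs]).

Definition link_gens (Fs : seq (seq nat)) (s : seq nat) : seq (seq nat) :=
  [seq [seq v <- f | v \notin s] | f <- Fs & all (mem f) s].

Lemma generated_closed Fs (G H : {set Vtx}) :
  G \in generated Fs -> H \subset G -> H \in generated Fs.
Proof.
rewrite !inE => /hasP[f fFs sGf] sHG; apply/hasP; exists f => //.
exact: subset_trans sGf.
Qed.

Lemma generatedP Fs (G : {set Vtx}) :
  all coded Fs ->
  reflect (exists s, [/\ coded s, has (subseq s) Fs & G = cset s])
          (G \in generated Fs).
Proof.
move=> /allP cFs; rewrite inE; apply: (iffP hasP) => [[f fFs sub]|[s [cs]]].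
  have [s ss ->] := sub_cset (cFs f fFs) sub.
  by exists s; split=> //; [apply: subseq_coded ss (cFs f fFs)|apply/hasP; exists f].
by case/hasP=> f fFs sf ->; exists f => //; rewrite (cset_subseq cs (cFs f fFs)).
Qed.

Lemma mem_faces_of Fs k s :
  (s \in faces_of Fs k) = (size s == k) && has (subseq s) Fs.
Proof.
rewrite mem_undup; apply/flatten_mapP/andP => [[f fFs]|[ks /hasP[f fFs sf]]].
  rewrite mem_filter mem_subseqs => /andP[-> sf].
  by split=> //; apply/hasP; exists f.
by exists f; rewrite // mem_filter ks mem_subseqs.
Qed.

Lemma card_generated Fs k :
  all coded Fs -> #|faces_card (generated Fs) k| = size (faces_of Fs k).
Proof.
move=> cFs; have coded_face s : s \in faces_of Fs k -> coded s.
  by rewrite mem_faces_of => /andP[_ /hasP[f /(allP cFs) cf /subseq_coded]]; apply.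
rewrite cardE -(size_map cset); apply/perm_size/uniq_perm.
- exact: enum_uniq.
- rewrite map_inj_in_uniq ?undup_uniq // => s t /coded_face cs /coded_face ct.
  exact: cset_inj.
move=> G; rewrite mem_enum inE; apply/andP/mapP => [[]|[s s_in ->]].
  case/generatedP=> // s [cs hs ->]; rewrite card_cset // => ks.
  by exists s; rewrite // mem_faces_of ks.
have cs := coded_face s s_in; move: s_in; rewrite mem_faces_of => /andP[ks hs].
by rewrite card_cset //; split=> //; apply/generatedP => //; exists s.
Qed.

Lemma link_generated Fs s :
  coded s -> link (generated Fs) (cset s) = generated (link_gens Fs s).
Proof.
move=> cs; apply/setP=> G; rewrite inE.
apply/andP/idP => [[_ /andP[dGs]]|].
  rewrite !inE => /hasP[f fFs]; rewrite subUset cset_subset // => /andP[sGf ssf].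
  apply/hasP; exists [seq v <- f | v \notin s].
    by apply/mapP; exists f; rewrite // mem_filter ssf.
  apply/subsetP=> x xG; have := subsetP sGf x xG.
  have := disjointFr dGs xG.
  by rewrite !inE mem_filter => -> ->.
rewrite inE => /hasP[f' /mapP[f]].
rewrite mem_filter => /andP[ssf fFs] ->{f'} /subsetP sub.
have sGf : G \subset cset f.
  by apply/subsetP=> x /sub; rewrite !inE mem_filter => /andP[].
split; first by rewrite inE; apply/hasP; exists f.
apply/andP; split.
- rewrite disjoint_subset; apply/subsetP=> x /sub.
  by rewrite !inE mem_filter => /andP[].
- by rewrite inE; apply/hasP; exists f; rewrite // subUset sGf cset_subset.
Qed.

Lemma link_gens_coded Fs s : all coded Fs -> all coded (link_gens Fs s).
Proof.
move=> cFs; apply/allP=> h /mapP[f]; rewrite mem_filter => /andP[_ fFs] ->{h}.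
exact: subseq_coded (filter_subseq _ _) (allP cFs f fFs).
Qed.

(** * Computable certificates of acyclicity *)

Fixpoint peelable_code (Hs : seq (seq nat)) : bool :=
  if Hs is h :: Hs' then
    has (fun v => ~~ has (subseq (rem v h)) Hs') h && peelable_code Hs'
  else true.

Lemma cset_rem (h : seq nat) (x : Vtx) :
  coded h -> cset (rem (code x) h) = cset h :\ x.
Proof.
case/andP=> sh _; apply/setP=> y; rewrite !inE mem_rem_uniq; last first.
  exact: sorted_uniq ltn_trans ltnn _ sh.
by rewrite inE (inj_eq code_inj).
Qed.

Lemma peelable_cset Hs :
  all coded Hs -> peelable_code Hs -> peelable [seq cset h | h <- Hs].
Proof.
elim: Hs => //= h Hs IH /andP[ch cHs] /andP[/hasP[v vh free] peelHs].
rewrite IH // andbT.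
have [x ex] : exists x, code x = v.
  by apply: code_onto; case/andP: ch => _ /allP; apply.
apply/exists_inP; exists x; first by rewrite inE ex.
rewrite -cset_rem // ex has_map; apply: contra free => /hasP[h' h'Hs] /= sub.
have cr : coded (rem v h) := subseq_coded (rem_subseq v h) ch.
by apply/hasP; exists h' => //; rewrite -(cset_subseq cr (allP cHs h' h'Hs)).
Qed.

(* [os] holds, for k = 1, ..., d, a peelable list of faces with k vertices. *)
Definition acyclic_cert (Fs : seq (seq nat)) (d : nat)
    (os : seq (seq (seq nat))) : bool :=
  all (fun k => (size (faces_of Fs k) <=
                 size (nth [::] ([::] :: os) k) + size (nth [::] os k))
                && peelable_code (nth [::] os k)
                && all (fun h => (size h == k.+1) && has (subseq h) Fs)
                       (nth [::] os k))
      (iota 0 d).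

(** The certified lists bound the ranks of two consecutive boundary maps from below, and the
    certificate makes these bounds add up to the number of faces between them. *)
Lemma acyclic_cert_vanishes (K : fieldType) Fs d os k :
  all coded Fs -> acyclic_cert Fs d os -> k < d ->
  (kermx (bdmx K (generated Fs) k) <= bdmx K (generated Fs) k.+1)%MS.
Proof.
move=> cFs /allP cert lt_kd.
have rank_ge l : l < d ->
  size (nth [::] os l) <= \rank (bdmx K (generated Fs) l.+1).
  move=> lt_ld; have := cert l; rewrite mem_iota lt_ld.
  move=> /(_ isT)/andP[/andP[_ peel] /allP in_faces].
  rewrite -(size_map cset); apply: peelable_rank.
  - exact: generated_closed.
  - move=> _ /mapP[h /in_faces/andP[kh hh] ->].
    have ch : coded h.
      by case/hasP: hh => f /(allP cFs) cf /subseq_coded; apply.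
    by rewrite inE card_cset // kh andbT; apply/generatedP => //; exists h.
  - apply: peelable_cset peel; apply/allP=> h /in_faces/andP[_ /hasP[f fFs sf]].
    exact: subseq_coded sf (allP cFs f fFs).
have := cert k; rewrite mem_iota lt_kd => /(_ isT)/andP[/andP[le_f _] _].
apply: rhom_vanishes_rank (rank_ge k lt_kd); first exact: generated_closed.
  by rewrite card_generated //; exact: le_f.
(* At [k = 0] the [[::]] prepended to [os] gives the trivial bound 0; otherwise the list is the one
   certified at the preceding index. *)
by case: k lt_kd {le_f} => [|k] lt_kd //=; apply: rank_ge; apply: ltnW.
Qed.

(** * The complex C_3 *)

Definition emb_code (j v : nat) : nat := if v \in Avert then 3 * v else 3 * v + j.

Definition copy (j : nat) (Fs : seq (seq nat)) : seq (seq nat) :=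
  [seq [seq emb_code j v | v <- f] | f <- Fs].

Definition C3_facets : seq (seq nat) :=
  flatten [seq copy j Qfacets | j <- iota 0 3].

Lemma C3_facets_coded : all coded C3_facets.
Proof. by vm_compute. Qed.

Lemma code_emb (j : 'I_3) (v : 'I_14) : code (emb j v) = emb_code j v.
Proof. by rewrite /code /emb /emb_code inE; case: ifP => _ //=; rewrite addn0. Qed.

Lemma C3_generated : C3 = generated C3_facets.
Proof.
apply/setP=> G; rewrite !inE; apply/existsP/hasP => [[j /existsP[F]]|[f]].
  rewrite !inE => /andP[/hasP[f fQ sFf] /eqP->].
  exists [seq emb_code j v | v <- f].
    apply/flatten_mapP; exists (val j); first by rewrite mem_iota ltn_ord.
    exact: (map_f (map (emb_code j))).
  apply/subsetP=> _ /imsetP[v vF ->]; rewrite inE code_emb map_f //.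
  by have := subsetP sFf v vF; rewrite inE.
case/flatten_mapP=> j; rewrite mem_iota => lt_j /mapP[f' fQ ->{f}] sGf.
exists (Ordinal lt_j); apply/existsP.
(* Cutting the preimage down to [f'] makes it a face of [Qstar] at once; it maps onto [G] because
   every code in [G] comes from a vertex of [f']. *)
exists (qface f' :&: emb (Ordinal lt_j) @^-1: G); rewrite inE.
apply/andP; split; first by apply/hasP; exists f'; rewrite ?subsetIl.
rewrite eqEsubset; apply/andP; split; apply/subsetP=> x; last first.
  by case/imsetP=> v; rewrite !inE => /andP[_ vG] ->.
move=> xG; have := subsetP sGf x xG; rewrite inE => /mapP[v vf ex].
have lt_v : v < 14.
  have /allP/(_ f' fQ)/allP/(_ v vf) // : all (all (gtn 14)) Qfacets by vm_compute.
have ex' : x = emb (Ordinal lt_j) (Ordinal lt_v).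
  by apply: code_inj; rewrite code_emb.
by rewrite ex'; apply: imset_f; rewrite !inE vf -ex'.
Qed.

(** A proper 4-coloring of the graph of Q^*, repeated in each copy; it depends only on the vertex of
    Q^*, hence agrees on A^*. *)
Definition vertex_colors : seq nat := [:: 0; 1; 2; 3; 2; 3; 0; 0; 0; 3; 0; 2; 1; 1].

Lemma C3_balanced : balanced C3 4.
Proof.
exists (fun x : Vtx => inord (nth 0 vertex_colors x.1)).
move=> G + _ x y + + ne_xy; rewrite C3_generated inE => /hasP[f fC sGf].
move=> /(subsetP sGf) + /(subsetP sGf); rewrite !inE => xf yf.
pose col n := nth 0 vertex_colors (n %/ 3).
have col_code (z : Vtx) : col (code z) = nth 0 vertex_colors z.1.
  by rewrite /col /code mulnC divnMDl // divn_small ?addn0.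
have col_lt z : nth 0 vertex_colors z < 4.
  have [lt_z|ge_z] := ltnP z 14; last by rewrite nth_default.
  have /allP small : all (gtn 4) vertex_colors by [].
  exact: small _ (mem_nth 0 (lt_z : z < size vertex_colors)).
apply: contraNneq ne_xy => /(congr1 val); rewrite /= !inordK // -!col_code => e.
(* Every edge lies in a facet, so it suffices that the colors on each facet are pairwise
   distinct. *)
have /allP/(_ f fC) uniq_col : all (fun f => uniq [seq col n | n <- f]) C3_facets.
  by vm_compute.
apply/eqP/code_inj; rewrite -(nth_index 0 xf) -(nth_index 0 yf).
congr nth; apply/eqP; rewrite -(nth_uniq 0 _ _ uniq_col) ?size_map ?index_mem //.
by rewrite !(nth_map 0) ?index_mem // !nth_index // e.
Qed.

Lemma C3_dim G : G \in C3 -> #|G| <= 4.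
Proof.
rewrite C3_generated inE => /hasP[f fC /subset_leq_card le_G].
apply: leq_trans le_G _; rewrite card_cset ?(allP C3_facets_coded) //.
have : all (fun f => size f <= 4) C3_facets by vm_compute.
by move/allP/(_ f fC).
Qed.

Lemma C3_fvector :
  [/\ #|faces_card C3 0| = 1, #|faces_card C3 1| = 22,
      #|faces_card C3 2| = 101, #|faces_card C3 3| = 140 &
      #|faces_card C3 4| = 60].
Proof.
by rewrite C3_generated !card_generated ?C3_facets_coded.
Qed.

(* A greedy search; nothing is proved about it, since [acyclic_cert] checks its
   output. *)
Fixpoint peel (n : nat) (Hs : seq (seq nat)) : seq (seq nat) :=
  if n is n'.+1 then
    let free h := has (fun v => ~~ has (subseq (rem v h)) (rem h Hs)) h in
    let i := find free Hs in
    if i < size Hs then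
      nth [::] Hs i :: peel n' (take i Hs ++ drop i.+1 Hs)
    else peel n' (behead Hs)
  else [::].

(** For each face [s], the empty one included, lists of faces of its link with 1, ..., 4 - #s
    vertices. They are stored evaluated, so that checking them does not repeat the search. *)
Definition link_certs : seq (seq nat * seq (seq (seq nat))) :=
  Eval vm_compute in
  [seq (s, [seq peel (size (faces_of (link_gens C3_facets s) k))
                     (rev (faces_of (link_gens C3_facets s) k))
           | k <- iota 1 (4 - size s)])
  | s <- undup (flatten [seq subseqs f | f <- C3_facets])].

Lemma link_certs_correct :
  all (fun p => acyclic_cert (link_gens C3_facets p.1) (4 - size p.1) p.2)
      link_certs.
Proof. by vm_compute. Qed.

Lemma link_certs_complete :
  all (fun f => all (fun s => s \in [seq p.1 | p <- link_certs]) (subseqs f))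
      C3_facets.
Proof. by vm_compute. Qed.

Lemma C3_cohen_macaulay (K : fieldType) : cohen_macaulay K C3 4.
Proof.
move=> F; rewrite C3_generated inE => /hasP[f fC sFf] i ne_i k def_k.
have cf := allP C3_facets_coded f fC.
have [s sf eF] := sub_cset cf sFf; have cs := subseq_coded sf cf.
have cL := link_gens_coded s C3_facets_coded.
rewrite eF in ne_i *; rewrite link_generated //.
rewrite card_cset // in ne_i.
(* Chains of degree [i] live on faces with [k = i + 1] vertices, so the exempted degree 3 - #s is
   [k = 4 - size s]. *)
have ne_k : k + size s != 4.
  apply: contraNneq ne_i => e; rewrite -(addrK 1%R i) -def_k.
  have -> : (4%:Z = k%:Z + (size s)%:Z)%R by rewrite -e PoszD.
  by rewrite addrAC addrK.
have [lt_k|ge_k] := ltnP k (4 - size s).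
  have /allP/(_ f fC)/allP/(_ s) := link_certs_complete.
  rewrite mem_subseqs sf => /(_ isT)/mapP[p p_in es].
  have /allP/(_ p p_in) := link_certs_correct; rewrite -es => cert.
  exact: acyclic_cert_vanishes cL cert lt_k.
(* Above the top degree there are no chains: a [k]-element face of the link, joined with [s], would
   have more than four vertices. *)
have f0 : #|faces_card (generated (link_gens C3_facets s)) k| = 0.
  apply/eqP; rewrite cards_eq0 -subset0; apply/subsetP=> G; rewrite inE.
  case/andP=> + /eqP kG; rewrite -link_generated // inE => /and3P[_ dGs].
  rewrite -C3_generated => /C3_dim; rewrite cardsU disjoint_setI0 // cards0 subn0.
  rewrite kG card_cset // => le4; move: ge_k ne_k.
  by rewrite leq_subLR addnC eqn_leq le4 => ->.
apply: (@rhom_vanishes_rank _ _ _ _ 0 0) => //; last by rewrite f0.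
exact: generated_closed.
Qed.

(** * Non-partitionability *)

(** Double counting: each entry of [W], with multiplicity, lies in exactly one interval. *)
Lemma partition_count (V : finType) (D : {set {set V}})
    (R : {set V} -> {set V}) (W : seq {set V}) :
  (forall G, G \in D ->
     exists F, [/\ F \in facets D, R F \subset G & G \subset F]) ->
  (forall G F1 F2 : {set V}, F1 \in facets D -> F2 \in facets D ->
     R F1 \subset G -> G \subset F1 ->
     R F2 \subset G -> G \subset F2 -> F1 = F2) ->
  {subset W <= D} ->
  \sum_(F in facets D)
    count (fun G : {set V} => (R F \subset G) && (G \subset F)) W = size W.
Proof.
move=> cover disj; elim: W => [|G W IH] sub /=; first by rewrite big1.
rewrite big_split IH /= => [|x xW]; last by apply: sub; rewrite inE xW orbT.
rewrite -add1n; congr addn.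
have [F [fF RG GF]] := cover G (sub G (mem_head _ _)).
rewrite (bigD1 F fF) /= RG GF big1 ?addn0 // => F' /andP[fF' neF].
by apply/eqP; rewrite eqb0; apply: contra neF => /andP[RG' GF']; apply/eqP/(disj G).
Qed.

(* Certificate found by linear programming: the weight of a face is the difference
   of its multiplicities in the two lists. *)
Definition weights_pos : seq (seq nat) :=
  [:: [:: 0; 5]; [:: 2; 5]; [:: 4; 5]; [:: 5; 7]; [:: 5; 12]; [:: 5; 13];
     [:: 0; 1; 5]; [:: 1; 2; 5]; [:: 1; 2; 6]; [:: 1; 4; 5]; [:: 1; 4; 8];
     [:: 1; 4; 8]; [:: 1; 5; 6]; [:: 1; 5; 7]; [:: 1; 5; 8]; [:: 1; 5; 11];
     [:: 2; 6; 9]; [:: 4; 5; 8]; [:: 4; 8; 9]; [:: 4; 8; 9]; [:: 5; 6; 11];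
     [:: 5; 8; 11]; [:: 5; 8; 13]].

Definition weights_neg : seq (seq nat) :=
  [:: [:: 5]; [:: 1; 5]; [:: 5; 6]; [:: 5; 8]; [:: 5; 11]; [:: 0; 2; 5];
     [:: 2; 5; 12]; [:: 4; 5; 7]; [:: 4; 5; 13]; [:: 0; 1; 2; 5];
     [:: 1; 2; 5; 6]; [:: 1; 2; 5; 6]; [:: 1; 2; 6; 9]; [:: 1; 4; 5; 7];
     [:: 1; 4; 5; 8]; [:: 1; 4; 5; 8]; [:: 1; 4; 5; 8]; [:: 1; 4; 8; 9];
     [:: 1; 4; 8; 9]; [:: 1; 5; 6; 11]; [:: 1; 5; 8; 11]; [:: 4; 5; 8; 13]].

Definition in_interval (r f w : seq nat) : bool := all (mem w) r && all (mem f) w.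

(* The edges {2, 6} and {4, 8} of A^*. *)
Definition shared_edges : seq (seq nat) := [:: [:: 6; 18]; [:: 12; 24]].

(** All candidate intervals are tried. For [i != j] both counts are 0, since every weighted face has
    a vertex outside A^* and so lies in no facet of another copy. *)
Lemma weights_interval :
  all (fun j => all (fun i => all (fun f => all (fun r =>
      (count (in_interval r f) (copy j weights_pos) <=
         count (in_interval r f) (copy j weights_neg))
      || (i == j) && has (in_interval r f) shared_edges)
    (subseqs f)) (copy i Qfacets)) (iota 0 3)) (iota 0 3).
Proof. by vm_compute. Qed.

Lemma weights_in_C3 :
  all (fun j => all (fun w => coded w && has (subseq w) C3_facets)
                    (copy j weights_pos ++ copy j weights_neg)) (iota 0 3).
Proof. by vm_compute. Qed.

(** Every facet of Q^* has a vertex outside A^*, so a facet of C_3 determines its copy. *)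
Lemma copies_disjoint :
  all (fun i => all (fun j => (i == j) ||
      ~~ has (mem (copy j Qfacets)) (copy i Qfacets)) (iota 0 3)) (iota 0 3).
Proof. by vm_compute. Qed.

Lemma facets_C3 F : F \in facets C3 -> exists2 f, f \in C3_facets & F = cset f.
Proof.
rewrite C3_generated inE => /andP[FC /forall_inP maxF].
move: FC; rewrite inE => /hasP[f fC sFf]; exists f => //.
have fD : cset f \in generated C3_facets by rewrite inE; apply/hasP; exists f.
by apply/eqP; rewrite eq_sym; apply: (implyP (maxF _ fD)).
Qed.

Lemma count_interval r f W :
  coded r -> all coded W ->
  count (fun G : {set Vtx} => (cset r \subset G) && (G \subset cset f))
    [seq cset w | w <- W]
  = count (in_interval r f) W.
Proof.
move=> cr cW; rewrite count_map; apply: eq_in_count => w wW /=.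
by rewrite /in_interval (cset_subset _ cr) (cset_subset _ (allP cW w wW)).
Qed.

(** The weights of copy [j] summed over all intervals give 23 - 22 = 1, so some interval has
    positive weight; by [weights_interval] it belongs to copy [j] and contains a shared edge. *)
Lemma partition_shared_edge (R : {set Vtx} -> {set Vtx}) (j : nat) :
  (forall F, F \in facets C3 -> R F \subset F) ->
  (forall G, G \in C3 <->
     exists F, [/\ F \in facets C3, R F \subset G & G \subset F]) ->
  (forall G F1 F2 : {set Vtx}, F1 \in facets C3 -> F2 \in facets C3 ->
     R F1 \subset G -> G \subset F1 ->
     R F2 \subset G -> G \subset F2 -> F1 = F2) ->
  j \in iota 0 3 ->
  exists f e, [/\ f \in copy j Qfacets, cset f \in facets C3, e \in shared_edges,
                  R (cset f) \subset cset e & cset e \subset cset f].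
Proof.
move=> subR coverR disjR j3.
have /allP/(_ j j3) := weights_in_C3; rewrite all_cat => /andP[posC negC].
have countW W : all (fun w => coded w && has (subseq w) C3_facets) W ->
    \sum_(F in facets C3)
      count (fun G : {set Vtx} => (R F \subset G) && (G \subset F))
        [seq cset w | w <- W] = size W.
  move=> /allP WC; rewrite (partition_count _ disjR) ?size_map //.
    by move=> G /coverR.
  move=> G /mapP[w /WC/andP[cw hw] ->]; rewrite C3_generated.
  by apply/generatedP; [exact: C3_facets_coded|exists w].
have coded_all W :
    all (fun w => coded w && has (subseq w) C3_facets) W -> all coded W.
  by move/allP=> WC; apply/allP=> w /WC/andP[].
pose E (F : {set Vtx}) :=
  [exists e : 'I_2, (R F \subset cset (nth [::] shared_edges e))
                    && (cset (nth [::] shared_edges e) \subset F)].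
pose inj (F : {set Vtx}) := has (fun f => F == cset f) (copy j Qfacets).
have [/exists_inP[F fF /andP[/hasP[f fQ /eqP eF] /existsP[e /andP[Re eFs]]]]|none] :=
  boolP [exists F in facets C3, inj F && E F].
  exists f, (nth [::] shared_edges e); rewrite -eF; split=> //.
  by rewrite mem_nth.
(* If there were no such interval, comparing the counts facet by facet would give 23 <= 22. *)
suff : size (copy j weights_pos) <= size (copy j weights_neg) by rewrite !size_map.
rewrite -!countW //; apply: leq_sum => F fF.
have [f fC eF] := facets_C3 fF; have cf := allP C3_facets_coded f fC.
have [r rf eR] : exists2 r, subseq r f & R F = cset r.
  by apply: sub_cset; rewrite // -eF subR.
have cr := subseq_coded rf cf.
rewrite eR eF !count_interval ?coded_all //.
have /flatten_mapP[i i3 fi] := fC.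
have /allP/(_ j j3)/allP/(_ i i3)/allP/(_ f fi)/allP/(_ r) := weights_interval.
rewrite mem_subseqs rf => /(_ isT)/orP[//|/andP[/eqP eij /hasP[e e_in inter]]].
case/negP: none; apply/exists_inP; exists F => //; apply/andP; split.
  by apply/hasP; exists f; rewrite ?eF // -eij.
have lt_e : index e shared_edges < 2 by rewrite -[2]/(size shared_edges) index_mem.
apply/existsP; exists (Ordinal lt_e) => /=; rewrite nth_index // eR eF.
have ce : coded e by apply: (allP (_ : all coded shared_edges) e e_in).
by rewrite !cset_subset.
Qed.

(* Three copies share two edges, so two copies compete for the same edge. *)
Lemma C3_not_partitionable : ~ partitionable C3.
Proof.
case=> R [subR coverR disjR].
have edge j := @partition_shared_edge R j subR coverR disjR.
have clash i j e f g : i \in iota 0 3 -> j \in iota 0 3 ->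
    f \in copy i Qfacets -> cset f \in facets C3 ->
    R (cset f) \subset cset e -> cset e \subset cset f ->
    g \in copy j Qfacets -> cset g \in facets C3 ->
    R (cset g) \subset cset e -> cset e \subset cset g -> i = j.
  move=> i3 j3 fi fC Rfe sef gj gC Rge seg.
  have in_C3 k h : k \in iota 0 3 -> h \in copy k Qfacets -> coded h.
    move=> k3 hk; apply: (allP C3_facets_coded).
    by apply/flatten_mapP; exists k.
  (* The intervals below [f] and [g] both contain the face [cset e], so disjointness identifies
     them. *)
  have efg : f = g.
    apply: cset_inj (in_C3 i f i3 fi) (in_C3 j g j3 gj) _.
    exact: (disjR (cset e)).
  have /allP/(_ i i3)/allP/(_ j j3)/orP[/eqP//|/hasP[]] := copies_disjoint.
  by exists f => //; rewrite /= efg.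
have [f0 [e0 [i0 C0 m0 R0 s0]]] := edge 0 isT.
have [f1 [e1 [i1 C1 m1 R1 s1]]] := edge 1 isT.
have [f2 [e2 [i2 C2 m2 R2 s2]]] := edge 2 isT.
have n01 : e0 != e1.
  apply/eqP=> e; rewrite -e in R1 s1.
  by have := clash 0 1 e0 f0 f1 isT isT i0 C0 R0 s0 i1 C1 R1 s1.
have n02 : e0 != e2.
  apply/eqP=> e; rewrite -e in R2 s2.
  by have := clash 0 2 e0 f0 f2 isT isT i0 C0 R0 s0 i2 C2 R2 s2.
have n12 : e1 != e2.
  apply/eqP=> e; rewrite -e in R2 s2.
  by have := clash 1 2 e1 f1 f2 isT isT i1 C1 R1 s1 i2 C2 R2 s2.
have uniq_e : uniq [:: e0; e1; e2] by rewrite /= !inE negb_or n01 n02 n12.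
have sub_e : {subset [:: e0; e1; e2] <= shared_edges}.
  by apply/allP; rewrite /= m0 m1 m2.
by have := uniq_leq_size uniq_e sub_e.
Qed.

Theorem theorem3p8 :
  [/\ balanced C3 4,
      (forall K : fieldType, cohen_macaulay K C3 4),
      ~ partitionable C3 &
      [/\ [/\ #|faces_card C3 0| = 1, #|faces_card C3 1| = 22,
              #|faces_card C3 2| = 101, #|faces_card C3 3| = 140 &
              #|faces_card C3 4| = 60] &
          (forall G, G \in C3 -> #|G| <= 4)]].
Proof.
split; [exact: C3_balanced|exact: C3_cohen_macaulay|exact: C3_not_partitionable|].
by split; [exact: C3_fvector|exact: C3_dim].
Qed.
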